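(* Let $0<\alpha\leq 1$, $s\leq s_\alpha$, and $\nu,\delta>0$. Then the estimate $$\|\partial_x(uv)\|_{X^{-1/2+\delta,s}_\alpha}\lesssim T^\nu\,\|u\|_{X^{1/2,s}_\alpha}\|v\|_{X^{1/2,s}_\alpha}$$ fails: there is no constant $C$ such that it holds for all $u,v\in X^{1/2,s}_\alpha$ with compact support (in time) in $[-T,T]$; that is, for any $C>0$ there exist such $u,v$ with $\|\partial_x(uv)\|_{X^{-1/2+\delta,s}_\alpha}> C\,T^\nu\|u\|_{X^{1/2,s}_\alpha}\|v\|_{X^{1/2,s}_\alpha}$.
   Context: For $0<\alpha\le 1$ set $s_\alpha=-3/4$ if $0<\alpha\leq 1/2$ and $s_\alpha=-\frac{3}{5-2\alpha}$ if $1/2<\alpha\leq 1$. For a function $u(t,x)$ on $\mathbb{R}^2$, $\widehat{u}(\tau,\xi)$ denotes its space-time Fourier transform ($\tau$ dual to $t$, $\xi$ dual to $x$), $\langle\cdot\rangle=(1+|\cdot|^2)^{1/2}$, and for $b,s\in\mathbb{R}$ the space $X^{b,s}_\alpha$ is defined by the norm $$\|u\|_{X^{b,s}_\alpha}=\big\|\langle i(\tau-\xi^3)+|\xi|^{2\alpha}\rangle^b\langle\xi\rangle^s\widehat{u}(\tau,\xi)\big\|_{L^2(\mathbb{R}^2)}.$$ *)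

(* Defs.v *)
(* Complex-valued functions on R^2 = R x R
   (coordinates (t, x)) are represented by a pair of real functions
   (real part, imaginary part). *)
From HB Require Import structures.
From mathcomp Require Import all_boot all_order all_algebra.
From mathcomp Require Import all_classical all_reals all_analysis.
Set Implicit Arguments. Unset Strict Implicit. Unset Printing Implicit Defensive.
Import Order.TTheory GRing.Theory Num.Theory.
Local Open Scope ring_scope.

Section Defs.
Variable R : realType.

Definition leb2 := ((@lebesgue_measure R) \x (@lebesgue_measure R))%E.

Definition s_alpha (a : R) : R :=
  if a <= 1/2 then - (3/4) else - (3 / (5 - 2 * a)).

Definition cfun := ((R * R -> R) * (R * R -> R))%type.

Definition cmul (u v : cfun) : cfun :=
  (fun p => u.1 p * v.1 p - u.2 p * v.2 p,
   fun p => u.1 p * v.2 p + u.2 p * v.1 p).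

Definition cabs2 (u : cfun) (p : R * R) : R := u.1 p ^+ 2 + u.2 p ^+ 2.

Definition cintegrable (u : cfun) : Prop :=
  leb2.-integrable setT (EFin \o u.1) /\ leb2.-integrable setT (EFin \o u.2).

(* space-time Fourier transform
   hat u (tau, xi) = \int\int e^{-i (t tau + x xi)} u(t,x) dt dx,
   for integrable u; the argument p of u is (t, x), that of hat u is (tau, xi). *)
Definition fourier (u : cfun) : cfun :=
  (fun q => Rintegral leb2 setT (fun p =>
       cos (p.1 * q.1 + p.2 * q.2) * u.1 p + sin (p.1 * q.1 + p.2 * q.2) * u.2 p),
   fun q => Rintegral leb2 setT (fun p =>
       cos (p.1 * q.1 + p.2 * q.2) * u.2 p - sin (p.1 * q.1 + p.2 * q.2) * u.1 p)).

(* multiplication on the Fourier side by i xi : the Fourier transform of d_x w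
   is i xi hat w *)
Definition mul_ixi (F : cfun) : cfun :=
  (fun q => - (q.2 * F.2 q), fun q => q.2 * F.1 q).

(* <z> = (1 + |z|^2)^(1/2) *)
Definition jbr (z2 : R) : R := Num.sqrt (1 + z2).

(* the weight <i(tau - xi^3) + |xi|^(2 alpha)>^b <xi>^s *)
Definition Xweight (a b s : R) (q : R * R) : R :=
  (jbr ((q.1 - q.2 ^+ 3) ^+ 2 + (`|q.2| `^ (2 * a)) ^+ 2)) `^ b
  * (jbr (q.2 ^+ 2)) `^ s.

Definition Xnorm_hat (a b s : R) (F : cfun) : \bar R :=
  ((\int[leb2]_(q in setT) ((Xweight a b s q) ^+ 2 * cabs2 F q)%:E) `^ (1/2))%E.

Definition Xnorm (a b s : R) (u : cfun) : \bar R := Xnorm_hat a b s (fourier u).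

Definition Xnorm_dx_prod (a b s : R) (u v : cfun) : \bar R :=
  Xnorm_hat a b s (mul_ixi (fourier (cmul u v))).

Definition time_supp_in (T : R) (u : cfun) : Prop :=
  forall p : R * R, T < `|p.1| -> u.1 p = 0 /\ u.2 p = 0.

End Defs.

(* Main.v *)
(* The counterexample is a high x high -> low interaction. With N large, w = N^beta,
   beta = max(0, alpha - 1/2), and L = N w^2, take the wave packet
     u(t, x) = e^{i (N^3 t + N x)} phi(L t) phi(w (x + 3 N^2 t)),   v = conj u,
   which travels at the group velocity of frequency N. On the Fourier side u is
   concentrated at |xi - N| ~ w, where the modulation tau - xi^3 and the dissipation
   |xi|^{2 alpha} are both O(L); so ||u||^2 and ||v||^2 are O(N^{2s} / w). The product
   uv = |u|^2 has frequency ~ w but modulation ~ N^2 w, whence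
     ||d_x(uv)||^2 >= c (N^2 w)^{-1+2 delta} w^{2s} / (N w).
   The squared quotient is at least N^{-3 - 4s + 2 beta s + 4 delta}, and
   -3 - 4s + 2 beta s >= 0 is exactly the condition s <= s_alpha. *)
Require Import Defs.
From HB Require Import structures.
From mathcomp Require Import all_boot all_order all_algebra.
From mathcomp Require Import all_classical all_reals all_analysis measurable_realfun.
From mathcomp Require Import ring lra.
Import Order.TTheory GRing.Theory Num.Theory.
Local Open Scope ring_scope.
Import numFieldNormedType.Exports.
Local Open Scope classical_set_scope.

(** The integral of a nonnegative function is a supremum over simple functions below it, and every
    simple function below [f] is below [g]. This compares the weighted Fourier integrands with
    explicit majorants and minorants without a proof that those integrands are measurable. *)
Lemma le_integral_nonneg d (T : measurableType d) (R : realType)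
    (mu : {measure set T -> \bar R}) (f g : T -> \bar R) :
  (forall x, (0 <= f x)%E) -> (forall x, (f x <= g x)%E) ->
  (\int[mu]_x f x <= \int[mu]_x g x)%E.
Proof.
move=> f0 fg; have g0 x : (0 <= g x)%E by apply: le_trans (fg x).
rewrite !ge0_integralTE//; apply: le_ereal_sup => _ [h /= hf <-].
by exists h => //= x; apply: le_trans (fg x).
Qed.

(** * Affine changes of variables *)

Section affine.
Context {R : realType}.
Local Notation mu := (@lebesgue_measure R).
Variables (a b : R).

Lemma measurable_affine : measurable_fun (T := measurableTypeR R)
  (U := measurableTypeR R) setT (fun x : R => a * x + b).
Proof. exact: measurable_funD. Qed.

Hypothesis a0 : 0 < a.

(** The right-hand side is a scaled pushforward measure, and it agrees with Lebesgue measure on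
    bounded intervals; uniqueness does the rest. *)
Lemma lebesgue_measure_affine (A : set R) : measurable A ->
  mu A = (a%:E * mu ((fun x => a * x + b)%R @^-1` A))%E.
Proof.
move=> mA.
pose p : {measure set (measurableTypeR R) -> \bar R} :=
  measure_function_pushforward__canonical__measure_function_Measure mu measurable_affine.
pose q : {measure set (measurableTypeR R) -> \bar R} := mscale (NngNum (ltW a0)) p.
suff -> : mu A = q A by [].
apply: lebesgue_measure_unique => // _ [[c d] _ <-] /=.
rewrite /q /= /mscale /= /pushforward /=.
have -> : (fun x => a * x + b)%R @^-1` `]c, d] = `](c - b) / a, (d - b) / a].
  apply/seteqP; split=> x /=;
    by rewrite !in_itv /= ltr_pdivrMr// ler_pdivlMr// ltrBlDr lerBrDr (mulrC x a).
rewrite !lebesgue_measure_itv /= !lte_fin ltr_pM2r ?invr_gt0// ltrD2r.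
case: ifP => _; last by rewrite mule0.
rewrite -!EFinD -EFinM; congr (_%:E).
by rewrite -mulrBl mulrC divfK ?gt_eqF// opprB addrA subrK.
Qed.

Lemma integral_affine (f : R -> \bar R) : measurable_fun (T := measurableTypeR R) setT f ->
  (forall x, 0 <= f x)%E ->
  (\int[mu]_x f (a * x + b)%R = a^-1%:E * \int[mu]_x f x)%E.
Proof.
move=> mf f0.
have := @ge0_integral_pushforward _ _ _ _ R _ measurable_affine mu setT f.
rewrite preimage_setT => /(_ measurableT mf (fun y _ => f0 y)) /= E.
rewrite -[LHS]E.
pose p' : {measure set (measurableTypeR R) -> \bar R} :=
  measure_function_pushforward__canonical__measure_function_Measure mu measurable_affine.
have -> : (\int[mu]_x f x = \int[mscale (NngNum (ltW a0)) p']_x f x)%E.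
  apply: eq_measure_integral => A mA _.
  exact: lebesgue_measure_affine.
rewrite ge0_integral_mscale//= muleA -EFinM mulVf ?gt_eqF// mul1e//.
Qed.
End affine.

Section shear.
Context {R : realType}.
Local Notation mR := (measurableTypeR R).
Local Notation mu2 := (@leb2 R).
Variables (a b c d e : R).
Hypotheses (a0 : 0 < a) (d0 : 0 < d).

(** Both maps are triangular with Jacobian [a * d]. [shear1] acts on $(t,x)$, where a moving packet
    depends on $x + ct$; [shear2] acts on $(\tau,\xi)$, where the dual variable is $\tau - c\xi$. *)
Definition shear1 (z : R * R) : R * R := (a * z.1 + b, d * z.2 + (c * z.1 + e)).
Definition shear2 (z : R * R) : R * R := (d * z.1 + (c * z.2 + e), a * z.2 + b).

Lemma measurable_shear1 : measurable_fun (T := (mR * mR)%type) (U := (mR * mR)%type) setT shear1.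
Proof.
apply: measurable_fun_pair.
  by apply: (measurableT_comp (measurable_affine a b)); exact: measurable_fst.
apply: measurable_funD; first by apply: measurable_funM => //; exact: measurable_snd.
by apply: (measurableT_comp (measurable_affine c e)); exact: measurable_fst.
Qed.

Lemma measurable_shear2 : measurable_fun (T := (mR * mR)%type) (U := (mR * mR)%type) setT shear2.
Proof.
apply: measurable_fun_pair; last first.
  by apply: (measurableT_comp (measurable_affine a b)); exact: measurable_snd.
apply: measurable_funD; first by apply: measurable_funM => //; exact: measurable_fst.
by apply: (measurableT_comp (measurable_affine c e)); exact: measurable_snd.
Qed.

(** By Tonelli, integrate first in the second coordinate: with the first one frozen the map is
    affine, and what remains is affine in the first coordinate. *)
Lemma ge0_integral_shear1 (f : mR * mR -> \bar R) : measurable_fun setT f ->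
  (forall z, 0 <= f z)%E ->
  (\int[mu2]_z f (shear1 z) = (a * d)^-1%:E * \int[mu2]_z f z)%E.
Proof.
move=> mf f0.
have mfs : measurable_fun setT (f \o shear1).
  by apply: measurableT_comp => //; exact: measurable_shear1.
rewrite /leb2 [LHS](@fubini_tonelli1 _ _ mR mR R lebesgue_measure lebesgue_measure (f \o shear1))//;
  last by move=> x; exact: f0.
rewrite [X in _ = (_ * X)%E](fubini_tonelli1 f)//.
rewrite invfM mulrC EFinM -muleA -(integral_affine _ b a0); first last.
- by move=> x; apply: integral_ge0.
- exact: measurable_fun_fubini_tonelli_F.
rewrite -ge0_integralZl//; first last.
- by rewrite lee_fin invr_ge0 ltW.
- by move=> x _; apply: integral_ge0.
- apply: (measurableT_comp _ (measurable_affine a b)).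
  exact: measurable_fun_fubini_tonelli_F.
apply: eq_integral => x _.
rewrite /fubini_F /shear1 /=.
rewrite (integral_affine _ (c * x + e) d0 (fun y => f (a * x + b, y)))//.
apply: measurableT_comp => //; exact: pair1_measurable.
Qed.

Lemma ge0_integral_shear2 (f : mR * mR -> \bar R) : measurable_fun setT f ->
  (forall z, 0 <= f z)%E ->
  (\int[mu2]_z f (shear2 z) = (a * d)^-1%:E * \int[mu2]_z f z)%E.
Proof.
move=> mf f0.
have mfs : measurable_fun setT (f \o shear2).
  by apply: measurableT_comp => //; exact: measurable_shear2.
rewrite /leb2 [LHS](@fubini_tonelli2 _ _ mR mR R lebesgue_measure lebesgue_measure (f \o shear2))//;
  last by move=> x; exact: f0.
rewrite [X in _ = (_ * X)%E](fubini_tonelli2 f)//.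
rewrite invfM mulrC EFinM -muleA -(integral_affine _ b a0); first last.
- by move=> x; apply: integral_ge0.
- exact: measurable_fun_fubini_tonelli_G.
rewrite -ge0_integralZl//; first last.
- by rewrite lee_fin invr_ge0 ltW.
- by move=> x _; apply: integral_ge0.
- apply: (measurableT_comp _ (measurable_affine a b)).
  exact: measurable_fun_fubini_tonelli_G.
apply: eq_integral => x _.
rewrite /fubini_G /shear2 /=.
rewrite (integral_affine _ (c * x + e) d0 (fun y => f (y, a * x + b)))//.
apply: measurableT_comp => //; exact: pair2_measurable.
Qed.

Lemma integrable_shear1 (f : mR * mR -> \bar R) : mu2.-integrable setT f ->
  mu2.-integrable setT (f \o shear1).
Proof.
move=> /integrableP[mf fi]; apply/integrableP; split.
  by apply: measurableT_comp => //; exact: measurable_shear1.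
rewrite (ge0_integral_shear1 (fun z => `|f z|%E)) //; last exact: measurableT_comp.
by rewrite lte_mul_pinfty// lee_fin invr_ge0 mulr_ge0// ltW.
Qed.

Lemma Rintegral_shear1 (f : mR * mR -> R) : mu2.-integrable setT (EFin \o f) ->
  Rintegral mu2 setT (f \o shear1) = (a * d)^-1 * Rintegral mu2 setT f.
Proof.
move=> fi; have /integrableP[mf fioo] := fi.
have -> : Rintegral mu2 setT (f \o shear1) = fine ((a * d)^-1%:E * \int[mu2]_z (f z)%:E)%E; last first.
  by rewrite fineM//; exact: integrable_fin_num.
congr fine; rewrite integralE [in RHS]integralE.
rewrite muleBr//; last exact: (integrable_add_def measurableT fi).
rewrite -(ge0_integral_shear1 ((EFin \o f)^\+%E)) //; last exact: measurable_funepos.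
rewrite -(ge0_integral_shear1 ((EFin \o f)^\-%E)) //; last exact: measurable_funeneg.
by congr (_ - _)%E; apply: eq_integral => z _; rewrite ?funeposE ?funenegE.

Qed.

End shear.

(** * Fourier decay of a polynomial bump *)

Section polynomial_fourier.
Context {R : realType}.
Local Notation mu := (@lebesgue_measure R).

Lemma is_derive_sin_scale (k x : R) :
  is_derive x (1 : R) (fun y => sin (k * y)) (k * cos (k * x)).
Proof.
have h : is_derive x (1 : R) (fun y => k * y) k.
  by apply: is_derive_eq; rewrite /GRing.scale /= mulr1.
have := @is_derive1_comp R sin (fun y => k * y) x _ _ (is_derive_sin (k * x)) h.
by rewrite mulrC.
Qed.

Lemma is_derive_cos_scale (k x : R) :
  is_derive x (1 : R) (fun y => cos (k * y)) (- (k * sin (k * x))).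
Proof.
have h : is_derive x (1 : R) (fun y => k * y) k.
  by apply: is_derive_eq; rewrite /GRing.scale /= mulr1.
have := @is_derive1_comp R cos (fun y => k * y) x _ _ (is_derive_cos (k * x)) h.
by rewrite mulNr mulrC.
Qed.

Lemma continuous_sin_scale (k : R) : continuous (fun y : R => sin (k * y)).
Proof.
move=> x; apply: differentiable_continuous; apply/derivable1_diffP.
by have [] := is_derive_sin_scale k x.
Qed.

Lemma continuous_cos_scale (k : R) : continuous (fun y : R => cos (k * y)).
Proof.
move=> x; apply: differentiable_continuous; apply/derivable1_diffP.
by have [] := is_derive_cos_scale k x.
Qed.

Lemma Rintegration_by_parts_global (F G f g : R -> R) (a b : R) : a < b ->
  continuous f -> continuous g ->
  (forall x, is_derive x (1 : R) F (f x)) ->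
  (forall x, is_derive x (1 : R) G (g x)) ->
  \int[mu]_(x in `[a, b]) (F x * g x) = F b * G b - F a * G a -
  \int[mu]_(x in `[a, b]) (f x * G x).
Proof.
move=> ab cf cg dF dG.
have D (H h : R -> R) : (forall x, is_derive x (1 : R) H (h x)) -> derivable_oo_LRcontinuous H a b.
  move=> dH; have cH : continuous H.
    by move=> x; apply: differentiable_continuous; apply/derivable1_diffP; have [] := dH x.
  split; first by move=> x _; have [] := dH x.
  - by apply: cvg_at_right_filter; exact: cH.
  - by apply: cvg_at_left_filter; exact: cH.
apply: Rintegration_by_parts => //.
- exact: continuous_subspaceT.
- exact: D dF.
- by move=> x _; rewrite derive1E; have [] := dF x.
- exact: continuous_subspaceT.
- exact: D dG.
- by move=> x _; rewrite derive1E; have [] := dG x.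
Qed.

Lemma integrable_continuous_itv (f : R -> R) (a b : R) : continuous f ->
  mu.-integrable `[a, b] (EFin \o f).
Proof.
move=> cf; apply: continuous_compact_integrable; first exact: segment_compact.
exact: continuous_subspaceT.
Qed.

Lemma Rintegral_horner_trig_le (p : {poly R}) (c : R -> R) : continuous c ->
  (forall x, `|c x| <= 1) ->
  `|\int[mu]_(x in `[-1, 1]) (p.[x] * c x)| <= \int[mu]_(x in `[-1, 1]) `|p.[x]|.
Proof.
move=> cc c1.
have ch : continuous (fun x => p.[x] * c x).
  by move=> x; apply: cvgM; [exact: continuous_horner|exact: cc].
apply: le_trans; first by apply: le_normr_Rintegral => //; exact: integrable_continuous_itv.
apply: le_Rintegral => //.
- by apply: (integrable_continuous_itv (fun x => `|p.[x] * c x|)) => x; apply: cvg_norm; exact: ch.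
- by apply: (integrable_continuous_itv (fun x => `|p.[x]|)) => x; apply: cvg_norm; exact: continuous_horner.
- by move=> x _; rewrite normrM ler_piMr.
Qed.

(* Each integration by parts gains a factor 1/k and costs one order of vanishing at the endpoints. *)
Lemma horner_trig_decay (j : nat) (r : {poly R}) :
  exists C : R, forall k : R,
    `|k ^+ j * \int[mu]_(x in `[-1, 1]) (((1 - 'X^2) ^+ j * r).[x] * cos (k * x))| <= C /\
    `|k ^+ j * \int[mu]_(x in `[-1, 1]) (((1 - 'X^2) ^+ j * r).[x] * sin (k * x))| <= C.
Proof.
elim: j r => [|j IH] r.
  exists (\int[mu]_(x in `[-1, 1]) `|r.[x]|) => k; rewrite !expr0 !mul1r; split.
    apply: Rintegral_horner_trig_le; first exact: continuous_cos_scale.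
    by move=> x; rewrite ler_norml cos_geN1 cos_le1.
  apply: Rintegral_horner_trig_le; first exact: continuous_sin_scale.
  by move=> x; rewrite ler_norml sin_geN1 sin_le1.
set q : {poly R} := 1 - 'X^2.
set p := q ^+ j.+1 * r.
(* Differentiating $q^{j+1} r$ loses one factor $q$ and leaves a new polynomial cofactor, to which
   the induction hypothesis applies. *)
pose r' := deriv q *+ j.+1 * r + q * deriv r.
have dp : deriv p = q ^+ j * r'.
  rewrite /p derivM deriv_exp /r' mulrDr exprS /= -!mulrA; congr (_ + _).
    by rewrite !mulrnAl !mulrnAr mulrCA mulrA.
  by rewrite mulrCA.
(* The boundary terms vanish because $q = 1 - X^2$ is zero at both endpoints. *)
have q1 (e : R) : e ^+ 2 = 1 -> p.[e] = 0.
  by move=> e1; rewrite /p hornerM horner_exp /q !hornerE e1 subrr expr0n mul0r.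
have p1 : p.[1] = 0 by apply: q1; rewrite expr1n.
have pN1 : p.[-1] = 0 by apply: q1; rewrite sqrrN expr1n.
have [C HC] := IH r'.
have N11 : -1 < 1 :> R by rewrite gtrN.
have parts (G g : R -> R) : continuous g -> (forall x, is_derive x (1 : R) G (g x)) ->
    \int[mu]_(x in `[-1, 1]) (p.[x] * g x) =
    - \int[mu]_(x in `[-1, 1]) ((q ^+ j * r').[x] * G x).
  move=> cg dG; rewrite (@Rintegration_by_parts_global (horner p) G (horner (deriv p)) g (-1) 1 N11)//.
    by rewrite p1 pN1 !mul0r subrr sub0r dp.
  exact: continuous_horner.
have pull (k : R) (c : R -> R) : continuous c ->
    k * \int[mu]_(x in `[-1, 1]) (p.[x] * c x) = \int[mu]_(x in `[-1, 1]) (p.[x] * (k * c x)).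
  move=> cc; rewrite -RintegralZl//; last first.
    apply: (integrable_continuous_itv (fun x => p.[x] * c x)) => x.
    by apply: cvgM; [exact: continuous_horner|exact: cc].
  by apply: eq_Rintegral => x _; rewrite mulrCA.
have cont (a : R) (c : R -> R) : continuous c -> continuous (fun y => a * c y).
  by move=> cc x; apply: cvgM; [exact: cvg_cst|exact: cc].
exists C => k; have [Hc Hs] := HC k; rewrite !exprSr -!mulrA; split.
  rewrite pull; last exact: continuous_cos_scale.
  rewrite (parts _ _ (cont k _ (continuous_cos_scale k)) (is_derive_sin_scale k)).
  by rewrite mulrN normrN.
(* The antiderivative of $-k\sin(kx)$ is $\cos(kx)$, so the sign is moved onto $k$ inside the
   absolute value. *)
rewrite -normrN -mulrN -mulNr pull; last exact: continuous_sin_scale.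
have dcos x : is_derive x (1 : R) (fun y => cos (k * y)) (- k * sin (k * x)).
  by rewrite mulNr; exact: is_derive_cos_scale.
rewrite (parts _ _ (cont (- k) _ (continuous_sin_scale k)) dcos).
by rewrite mulrN normrN.
Qed.
End polynomial_fourier.

Section bump.
Context {R : realType}.
Local Notation mR := (measurableTypeR R).
Local Notation mu := (@lebesgue_measure R).
Local Notation mu2 := (@leb2 R).

(** A bump of finite smoothness suffices, since only a fixed polynomial rate of Fourier decay is
    used; moreover its square is again a bump. For [k = 0] it is the constant 1, so compact support
    needs an index [k.+1]. *)
Definition bump (k : nat) (x : R) : R := (Num.max 0 (1 - x ^+ 2)) ^+ k.

Lemma bump_ge0 k x : 0 <= bump k x.
Proof. by rewrite exprn_ge0// le_max lexx. Qed.

Lemma bump_eq0 k x : 1 < `|x| -> bump k.+1 x = 0.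
Proof.
move=> x1; rewrite /bump max_l ?expr0n// subr_le0 -real_normK ?num_real//.
by rewrite exprn_ege1// ltW.
Qed.

Lemma bumpM k x : bump k x ^+ 2 = bump (k * 2) x.
Proof. by rewrite /bump exprM. Qed.

Lemma bump_horner k (x : R) : x \in `[-1, 1]%R -> bump k x = ((1 - 'X^2) ^+ k).[x].
Proof.
rewrite in_itv /= -ler_norml => x1; rewrite horner_exp !hornerE /bump max_r//.
by rewrite subr_ge0 -real_normK ?num_real// exprn_ile1.
Qed.

Lemma bump_patch k (c : R -> R) :
  (fun x => bump k.+1 x * c x) = ((fun x => ((1 - 'X^2) ^+ k.+1).[x] * c x) \_ `[-1, 1]).
Proof.
apply/funext => x; rewrite patchE; case: ifPn => [|/negP x1].
  by rewrite inE /= => x1; rewrite bump_horner.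
rewrite bump_eq0 ?mul0r// ltNge; apply/negP => h; apply: x1.
by rewrite inE /= in_itv /= -ler_norml.
Qed.

Lemma integrable_bump k (c : R -> R) : continuous c ->
  mu.-integrable setT (EFin \o (fun x => bump k.+1 x * c x)).
Proof.
move=> cc; rewrite bump_patch.
rewrite -restrict_EFin.
apply: (iffLR (integrable_mkcond _ _)) => //.
apply: (integrable_continuous_itv (fun x => ((1 - 'X^2) ^+ k.+1).[x] * c x)) => x.
by apply: cvgM; [exact: continuous_horner|exact: cc].
Qed.

Lemma Rintegral_bump k (c : R -> R) :
  \int[mu]_x (bump k.+1 x * c x) =
  \int[mu]_(x in `[-1, 1]) (((1 - 'X^2) ^+ k.+1).[x] * c x).
Proof. by rewrite bump_patch [RHS]Rintegral_mkcond. Qed.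

Lemma exprn_oneDsqr_le k (x : R) : (1 + x ^+ 2) ^+ k <= 2 ^+ k * (1 + (x ^+ k) ^+ 2).
Proof.
have [x1|x1] := leP (x ^+ 2) 1.
  apply: (@le_trans _ _ (2 ^+ k)).
    by rewrite lerXn2r ?nnegrE//; have := sqr_ge0 x; lra.
  by rewrite ler_peMr ?exprn_ge0// lerDl sqr_ge0.
apply: (@le_trans _ _ ((2 * x ^+ 2) ^+ k)).
  rewrite lerXn2r ?nnegrE//; have := sqr_ge0 x; lra.
by rewrite exprMn exprAC ler_wpM2l ?exprn_ge0// lerDr.
Qed.

(** Integrating by parts zero times bounds the transform $I(x)$, and $k+1$ times bounds $x^{k+1}
    I(x)$; together they absorb $(1+x^2)^{k+1}$ by [exprn_oneDsqr_le]. *)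
Lemma bump_fourier_decay k : exists2 C : R, 0 <= C & forall x : R,
  (1 + x ^+ 2) ^+ k.+1 * (\int[mu]_y (bump k.+1 y * cos (x * y))) ^+ 2 <= C /\
  (1 + x ^+ 2) ^+ k.+1 * (\int[mu]_y (bump k.+1 y * sin (x * y))) ^+ 2 <= C.
Proof.
have [A HA] := horner_trig_decay 0 ((1 - 'X^2) ^+ k.+1 : {poly R}).
have [B HB] := horner_trig_decay k.+1 (1 : {poly R}).
have A0 : 0 <= A by have [h _] := HA 0; exact: le_trans h.
have B0 : 0 <= B by have [h _] := HB 0; exact: le_trans h.
have key (x I : R) : `|I| <= A -> `|x ^+ k.+1 * I| <= B ->
    (1 + x ^+ 2) ^+ k.+1 * I ^+ 2 <= 2 ^+ k.+1 * (A ^+ 2 + B ^+ 2).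
  move=> hA hB; apply: le_trans.
    by apply: ler_wpM2r; [exact: sqr_ge0|exact: exprn_oneDsqr_le].
  rewrite -mulrA ler_wpM2l ?exprn_ge0// mulrDl mul1r -exprMn.
  by apply: lerD; rewrite -real_normK ?num_real// lerXn2r ?nnegrE.
exists (2 ^+ k.+1 * (A ^+ 2 + B ^+ 2)).
  by rewrite mulr_ge0 ?exprn_ge0 ?addr_ge0 ?sqr_ge0.
move=> x; have [Ac As] := HA x; have [Bc Bs] := HB x.
by rewrite !Rintegral_bump; split; apply: key;
   rewrite ?expr0 ?mul1r ?mulr1 in Ac As Bc Bs.
Qed.
End bump.

(** * Product functions on the plane and their Fourier transforms *)

Section tensor.
Context {R : realType}.
Local Notation mR := (measurableTypeR R).
Local Notation mu := (@lebesgue_measure R).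
Local Notation mu2 := (@leb2 R).

Lemma integrable_tensor (f g : mR -> R) :
  mu.-integrable setT (EFin \o f) -> mu.-integrable setT (EFin \o g) ->
  mu2.-integrable setT (EFin \o (fun z : mR * mR => f z.1 * g z.2)).
Proof.
move=> /integrableP[/measurable_EFinP mf fi] /integrableP[/measurable_EFinP mg gi].
have mfg : measurable_fun setT (fun z : mR * mR => f z.1 * g z.2).
  apply: measurable_funM.
    by apply: (measurableT_comp mf); exact: measurable_fst.
  by apply: (measurableT_comp mg); exact: measurable_snd.
apply/integrableP; split; first exact/measurable_EFinP.
have mabs : measurable_fun setT (fun z : mR * mR => `|(f z.1 * g z.2)%:E|%E).
  by apply: measurableT_comp => //; exact/measurable_EFinP.
rewrite /leb2 (fubini_tonelli1 _ mabs)//.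
rewrite /fubini_F /=.
under eq_integral => x _.
  under eq_integral => y _ do rewrite normrM EFinM.
  rewrite ge0_integralZl//; last by apply/measurable_EFinP; apply: measurableT_comp.
  over.
have mabsf : measurable_fun setT (fun x : mR => `|f x|%:E).
  by apply/measurable_EFinP; apply: measurableT_comp.
rewrite (ge0_integralZr _ measurableT mabsf)//; last exact: integral_ge0.
by apply: lte_mul_pinfty => //; [exact: integral_ge0|rewrite ge0_fin_numE//; exact: integral_ge0].
Qed.

Lemma Rintegral_tensor (f g : mR -> R) :
  mu.-integrable setT (EFin \o f) -> mu.-integrable setT (EFin \o g) ->
  Rintegral mu2 setT (fun z : mR * mR => f z.1 * g z.2) =
  (\int[mu]_x f x) * (\int[mu]_x g x).
Proof.
move=> fi gi; have fgi := integrable_tensor _ _ fi gi.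
rewrite /Rintegral /leb2 -(integral12_prod_meas1 fgi) /fubini_F /=.
have gfin : (\int[mu]_x (g x)%:E)%E \is a fin_num by exact: integrable_fin_num.
under eq_integral => x _.
  under eq_integral => y _ do rewrite EFinM.
  rewrite integralZl// -(fineK gfin); over.
by rewrite integralZr// fineM//; exact: integrable_fin_num.
Qed.

Definition bump2 (k : nat) (z : R * R) : R := bump k z.1 * bump k z.2.

Lemma bump2_ge0 k z : 0 <= bump2 k z.
Proof. by rewrite mulr_ge0 ?bump_ge0. Qed.

Lemma integrable_bump_self k : mu.-integrable setT (EFin \o bump k.+1).
Proof.
rewrite (_ : bump k.+1 = fun x : R => bump k.+1 x * cst 1 x); last first.
  by apply/funext => x; rewrite /= mulr1.
exact: integrable_bump (fun x => cvg_cst _).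
Qed.

Lemma integrable_bump2 k : mu2.-integrable setT (EFin \o bump2 k.+1).
Proof. by apply: integrable_tensor; exact: integrable_bump_self. Qed.

Lemma measurable_phase (h : R -> R) (p q : R) : continuous h ->
  measurable_fun (T := (mR * mR)%type) setT (fun z => h (z.1 * p + z.2 * q)).
Proof.
move=> ch; apply: (measurableT_comp (f := h : mR -> mR)).
  exact: continuous_measurable_fun.
by apply: measurable_funD; apply: measurable_funM.
Qed.

Lemma integrable_phase_bump2 k (h : R -> R) (p q : R) : continuous h ->
  (forall x, `|h x| <= 1) ->
  mu2.-integrable setT (EFin \o (fun z => h (z.1 * p + z.2 * q) * bump2 k.+1 z)).
Proof.
move=> ch h1; have bi := integrable_bump2 k.
apply: (le_integrable measurableT _ _ bi).
  have /integrableP[/measurable_EFinP mb _] := bi.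
  by apply/measurable_EFinP; apply: measurable_funM => //; exact: measurable_phase.
by move=> z _ /=; rewrite lee_fin normrM ler_piMl.
Qed.

Lemma cos_norm_le1 (x : R) : `|cos x| <= 1.
Proof. by rewrite ler_norml cos_geN1 cos_le1. Qed.

Lemma sin_norm_le1 (x : R) : `|sin x| <= 1.
Proof. by rewrite ler_norml sin_geN1 sin_le1. Qed.

(** The addition formulas for cosine and sine split the transform into four products of one-variable
    integrals. Each weighted square is at most $C^2$, and $(x \pm y)^2 \le 2x^2 + 2y^2$ turns this
    into $8C^2$. *)
Lemma bump2_fourier_decay k : exists2 C : R, 0 <= C & forall p q : R,
  (1 + p ^+ 2) ^+ k.+1 * (1 + q ^+ 2) ^+ k.+1 *
  ((Rintegral mu2 setT (fun z => cos (z.1 * p + z.2 * q) * bump2 k.+1 z)) ^+ 2 +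
   (Rintegral mu2 setT (fun z => sin (z.1 * p + z.2 * q) * bump2 k.+1 z)) ^+ 2) <= C.
Proof.
have [C C0 HC] := @bump_fourier_decay R k.
exists (8 * C ^+ 2); first by rewrite mulr_ge0 ?sqr_ge0.
move=> p q; have [cp sp] := HC p; have [cq sq] := HC q.
set Ic := fun x : R => \int[mu]_y (bump k.+1 y * cos (x * y)) in cp cq.
set Is := fun x : R => \int[mu]_y (bump k.+1 y * sin (x * y)) in sp sq.
have ic x : mu.-integrable setT (EFin \o (fun y => bump k.+1 y * cos (x * y))).
  by apply: integrable_bump; exact: continuous_cos_scale.
have is_ x : mu.-integrable setT (EFin \o (fun y => bump k.+1 y * sin (x * y))).
  by apply: integrable_bump; exact: continuous_sin_scale.
have -> : Rintegral mu2 setT (fun z => cos (z.1 * p + z.2 * q) * bump2 k.+1 z) =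
    Ic p * Ic q - Is p * Is q.
  rewrite /Ic /Is -!Rintegral_tensor// -RintegralB//; last 2 first.
  - exact: (integrable_tensor _ _ (ic p) (ic q)).
  - exact: (integrable_tensor _ _ (is_ p) (is_ q)).
  apply: eq_Rintegral => z _ /=; rewrite cosD /bump2 ![z.1 * p]mulrC ![z.2 * q]mulrC.
  by ring.
have -> : Rintegral mu2 setT (fun z => sin (z.1 * p + z.2 * q) * bump2 k.+1 z) =
    Is p * Ic q + Ic p * Is q.
  rewrite /Ic /Is -!Rintegral_tensor// -RintegralD//; last 2 first.
  - exact: (integrable_tensor _ _ (is_ p) (ic q)).
  - exact: (integrable_tensor _ _ (ic p) (is_ q)).
  apply: eq_Rintegral => z _ /=; rewrite sinD /bump2 ![z.1 * p]mulrC ![z.2 * q]mulrC.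
  by ring.
set P := (1 + p ^+ 2) ^+ k.+1 in cp sp *; set Q := (1 + q ^+ 2) ^+ k.+1 in cq sq *.
have P0 : 0 <= P by rewrite exprn_ge0// addr_ge0 ?sqr_ge0.
have Q0 : 0 <= Q by rewrite exprn_ge0// addr_ge0 ?sqr_ge0.
have m (x y : R) : P * x ^+ 2 <= C -> Q * y ^+ 2 <= C ->
    P * Q * (x * y) ^+ 2 <= C ^+ 2.
  move=> hx hy; rewrite exprMn mulrACA [C ^+ 2]expr2.
  by apply: ler_pM => //; rewrite mulr_ge0 ?sqr_ge0.
have H1 := m _ _ cp cq; have H2 := m _ _ sp sq.
have H3 := m _ _ sp cq; have H4 := m _ _ cp sq.
have sq2 (x y : R) : (x - y) ^+ 2 <= 2 * x ^+ 2 + 2 * y ^+ 2.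
  by have := sqr_ge0 (x + y); nra.
have sq3 (x y : R) : (x + y) ^+ 2 <= 2 * x ^+ 2 + 2 * y ^+ 2.
  by have := sqr_ge0 (x - y); nra.
have PQ : 0 <= P * Q by rewrite mulr_ge0.
apply: (@le_trans _ _ (P * Q * (2 * (Ic p * Ic q) ^+ 2 + 2 * (Is p * Is q) ^+ 2 +
  (2 * (Is p * Ic q) ^+ 2 + 2 * (Ic p * Is q) ^+ 2)))).
  by rewrite ler_wpM2l// lerD.
rewrite !mulrDr !(mulrCA (P * Q) 2).
move: H1 H2 H3 H4.
move: (P * Q * _) (P * Q * _) (P * Q * _) (P * Q * _) (C ^+ 2) => A1 A2 A3 A4 D.
by lra.
Qed.

End tensor.

(** * Wave packets *)

Section packet.
Context {R : realType}.
Local Notation mR := (measurableTypeR R).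
Local Notation mu := (@lebesgue_measure R).
Local Notation mu2 := (@leb2 R).

(** An envelope of duration $1/L$ and width $1/w$, transported with velocity $-c$. The choice $c =
    3N^2$ matches the slope of $\tau = \xi^3$ at $\xi = \pm N$. *)
Definition packet (k : nat) (L w c : R) (z : R * R) : R :=
  bump k (L * z.1) * bump k (w * (z.2 + c * z.1)).

Definition wave (a b : R) (P : R * R -> R) : cfun R :=
  (fun z => cos (z.1 * a + z.2 * b) * P z, fun z => sin (z.1 * a + z.2 * b) * P z).

Lemma packet_shear k L w c :
  packet k L w c = bump2 k \o shear1 L 0 (w * c) w 0.
Proof.
by apply/funext => z; rewrite /packet /bump2 /shear1 /= !addr0 mulrDr addrC mulrA [w * z.2 + _]addrC.
Qed.

Lemma packetM k L w c z : packet k L w c z ^+ 2 = packet (k * 2) L w c z.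
Proof. by rewrite exprMn !bumpM. Qed.

(** The frequencies transform by the inverse transpose of the shear, which makes $(p - cq)/L$ and
    $q/w$ the natural dual variables. *)
Lemma phase_packet k L w c (h : R -> R) (p q : R) : 0 < L -> 0 < w ->
  (fun z => h (z.1 * p + z.2 * q) * packet k L w c z) =
  (fun z => h (z.1 * ((p - c * q) / L) + z.2 * (q / w)) * bump2 k z) \o
    shear1 L 0 (w * c) w 0.
Proof.
move=> L0 w0; apply/funext => z; rewrite packet_shear /=; congr (h _ * _).
by field; rewrite !gt_eqF.
Qed.

Lemma integrable_phase_packet k L w c (h : R -> R) (p q : R) : 0 < L -> 0 < w ->
  continuous h -> (forall x, `|h x| <= 1) ->
  mu2.-integrable setT (EFin \o (fun z => h (z.1 * p + z.2 * q) * packet k.+1 L w c z)).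
Proof.
move=> L0 w0 ch h1; rewrite phase_packet//.
exact: (integrable_shear1 _ _ _ _ _ L0 w0 _ (integrable_phase_bump2 _ _ _ _ ch h1)).
Qed.

Lemma Rintegral_phase_packet k L w c (h : R -> R) (p q : R) : 0 < L -> 0 < w ->
  continuous h -> (forall x, `|h x| <= 1) ->
  Rintegral mu2 setT (fun z => h (z.1 * p + z.2 * q) * packet k.+1 L w c z) =
  (L * w)^-1 * Rintegral mu2 setT
    (fun z => h (z.1 * ((p - c * q) / L) + z.2 * (q / w)) * bump2 k.+1 z).
Proof.
move=> L0 w0 ch h1; rewrite phase_packet//.
exact: (Rintegral_shear1 _ _ _ _ _ L0 w0 _ (integrable_phase_bump2 _ _ _ _ ch h1)).
Qed.

Lemma fourier_wave1 a b (P : R * R -> R) (q : R * R) : (fourier (wave a b P)).1 q =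
  Rintegral mu2 setT (fun z => cos (z.1 * (a - q.1) + z.2 * (b - q.2)) * P z).
Proof.
apply: eq_Rintegral => z _ /=.
have -> : z.1 * (a - q.1) + z.2 * (b - q.2) = (z.1 * a + z.2 * b) - (z.1 * q.1 + z.2 * q.2) by ring.
by rewrite cosB; ring.
Qed.

Lemma fourier_wave2 a b (P : R * R -> R) (q : R * R) : (fourier (wave a b P)).2 q =
  Rintegral mu2 setT (fun z => sin (z.1 * (a - q.1) + z.2 * (b - q.2)) * P z).
Proof.
apply: eq_Rintegral => z _ /=.
have -> : z.1 * (a - q.1) + z.2 * (b - q.2) = (z.1 * a + z.2 * b) - (z.1 * q.1 + z.2 * q.2) by ring.
by rewrite sinB; ring.
Qed.

(** Modulation translates the transform and the shear rescales it with factor $1/(Lw)$, so the decay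
    of the fixed bump carries over with a constant uniform in all parameters. *)
Lemma cabs2_fourier_wave_le k : exists2 C : R, 0 <= C & forall (L w c a b : R) (q : R * R),
  0 < L -> 0 < w ->
  (1 + ((q.1 - a - c * (q.2 - b)) / L) ^+ 2) ^+ k.+1 * (1 + ((q.2 - b) / w) ^+ 2) ^+ k.+1 *
  cabs2 (fourier (wave a b (packet k.+1 L w c))) q <= C * (L * w) ^- 2.
Proof.
have [C C0 HC] := @bump2_fourier_decay R k.
exists C => // L w c a b q L0 w0.
have csin : continuous (@sin R) by exact: continuous_sin.
have ccos : continuous (@cos R) by exact: continuous_cos.
rewrite /cabs2 fourier_wave1 fourier_wave2.
rewrite (Rintegral_phase_packet _ _ _ _ _ _ _ L0 w0 ccos cos_norm_le1).
rewrite (Rintegral_phase_packet _ _ _ _ _ _ _ L0 w0 csin sin_norm_le1).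
have := HC ((a - q.1 - c * (b - q.2)) / L) ((b - q.2) / w).
set A := Rintegral _ _ _; set B := Rintegral _ _ _ => H.
rewrite -[q.2 - b]opprB -[q.1 - a]opprB mulrN -opprD !mulNr !sqrrN.
rewrite ![(_^-1 * _) ^+ 2]exprMn -mulrDr mulrCA exprVn [leRHS]mulrC ler_wpM2l//.
by rewrite invr_ge0 exprn_ge0// mulr_ge0// ltW.
Qed.

End packet.

(** * Pointwise bounds for the weight near the carrier frequency *)

Section weight.
Context {R : realType}.
Implicit Types (s a b N w : R).

Lemma powR_sqr (x r : R) : (x `^ r) ^+ 2 = x `^ (r * 2).
Proof. by rewrite powRrM powR_mulrn// powR_ge0. Qed.

Lemma jbr_powR (z r : R) : 0 <= z -> jbr z `^ r = (1 + z) `^ (r / 2).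
Proof.
by move=> z0; rewrite /jbr -powR12_sqrt ?addr_ge0// -powRrM mulrC.
Qed.

Lemma ler_npowR (x y s : R) : 0 < x -> x <= y -> s <= 0 -> y `^ s <= x `^ s.
Proof.
move=> x0 xy s0; have y0 := lt_le_trans x0 xy.
rewrite -[s]opprK !(powRN _ (- s)) lef_pV2 ?posrE ?powR_gt0//.
by rewrite ge0_ler_powR ?nnegrE ?oppr_ge0// ltW.
Qed.

Lemma jbr_le (x y : R) : 0 <= y -> jbr (x ^+ 2 + y ^+ 2) <= 1 + `|x| + y.
Proof.
move=> y0; rewrite /jbr.
have h : 0 <= 1 + `|x| + y by rewrite !addr_ge0.
rewrite -[leRHS]ger0_norm// -sqrtr_sqr ler_sqrt ?sqr_ge0//.
rewrite -[x ^+ 2]real_normK ?num_real//.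
have := normr_ge0 x; nra.
Qed.

Lemma jbr_ge1 (z : R) : 0 <= z -> 1 <= jbr z.
Proof. by move=> z0; rewrite /jbr -[leLHS]sqrtr1 ler_sqrt ?addr_ge0// lerDl. Qed.

Lemma Xweight_half_sqr a s (q : R * R) : (Xweight a (1/2) s q) ^+ 2 =
  jbr ((q.1 - q.2 ^+ 3) ^+ 2 + (`|q.2| `^ (2 * a)) ^+ 2) * (1 + q.2 ^+ 2) `^ s.
Proof.
rewrite /Xweight exprMn !powR_sqr; congr (_ * _).
  by rewrite (_ : 1 / 2 * 2 = 1) ?powRr1 ?sqrtr_ge0//; lra.
by rewrite jbr_powR ?sqr_ge0// mulfK// pnatr_eq0.
Qed.

(* From N <= |x| + w |t| and w^2 <= N one gets N <= 2 |x| + t^2, which trades the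
   loss of the frequency localisation for powers of the rescaled variable t *)
Lemma low_frequency_weight (N w t x e s : R) (m : nat) :
  1 <= N -> 1 <= w -> w ^+ 2 <= N -> e ^+ 2 = 1 -> x = e * N + w * t ->
  s <= 0 -> - s <= m%:R ->
  (1 + x ^+ 2) `^ s <= N `^ (2 * s) * (4 * (1 + t ^+ 2) ^+ 2) ^+ m.
Proof.
move=> N1 w1 wN e1 xE s0 sm.
have N0 : 0 < N by lra.
have ax : N <= 2 * `|x| + t ^+ 2.
  have h1 : N <= `|x| + w * `|t|.
    have -> : N = `|x - w * t|.
      by rewrite xE addrK normrM (ger0_norm (ltW N0)) -sqrtr_sqr e1 sqrtr1 mul1r.
    by rewrite (le_trans (ler_normB _ _))// normrM (ger0_norm (_ : 0 <= w))//; lra.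
  have h2 : w * `|t| <= (N + t ^+ 2) / 2.
    have t2 : `|t| ^+ 2 = t ^+ 2 by rewrite real_normK ?num_real.
    have wt : (w * `|t|) ^+ 2 <= N * t ^+ 2 by rewrite exprMn t2 ler_wpM2r ?sqr_ge0.
    have t0 := sqr_ge0 t.
    rewrite -ler_sqr ?nnegrE ?mulr_ge0//; [|lra..].
    apply: (le_trans wt).
    have := sqr_ge0 (N - t ^+ 2); nra.
  lra.
have key : N ^+ 2 / (4 * (1 + t ^+ 2) ^+ 2) <= 1 + x ^+ 2.
  have x2 : `|x| ^+ 2 = x ^+ 2 by rewrite real_normK ?num_real.
  have t0 := sqr_ge0 t; have x0 := normr_ge0 x.
  rewrite ler_pdivrMr; last by rewrite mulr_gt0// exprn_gt0//; lra.
  apply: (@le_trans _ _ ((2 * `|x| + t ^+ 2) ^+ 2)).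
    by rewrite lerXn2r ?nnegrE; lra.
  rewrite -x2; move: (`|x|) (t ^+ 2) x0 t0 => y u y0 u0.
  (* Cauchy-Schwarz: $(4+u^2)(1+y^2) - (2y+u)^2 = (2-uy)^2$, and $4+u^2 \le 4(1+u)^2$. *)
  have := sqr_ge0 (2 - u * y); have := sqr_ge0 y; have := mulr_ge0 u0 (sqr_ge0 y).
  nra.
have D0 : 0 < 4 * (1 + t ^+ 2) ^+ 2 by rewrite mulr_gt0// exprn_gt0//; have := sqr_ge0 t; lra.
have D1 : 1 <= 4 * (1 + t ^+ 2) ^+ 2 by have := sqr_ge0 t; nra.
apply: (le_trans (ler_npowR _ _ _ _ key s0)); first by rewrite divr_gt0// exprn_gt0.
rewrite powRM ?invr_ge0 ?sqr_ge0 ?(ltW D0)//.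
rewrite -powR_inv1 ?(ltW D0)// -powRrM mulN1r.
rewrite -(powR_mulrn 2 (ltW N0)) -powRrM ler_wpM2l ?powR_ge0//.
by rewrite -(powR_mulrn m (ltW D0)) ler_powR.
Qed.

(** The sign $e$ selects the carrier $\pm N$. The terms of $x^3$ of order 0 and 1 in $t$ cancel
    against $y$, leaving $Lp - 3eLt^2 - w^3t^3$ with $L = Nw^2$ and $w^3 \le L$. The dissipation is
    at most $N^{2a}(1+|t|)^2 \le L(1+|t|)^2$. *)
Lemma dispersive_weight (N w t p x y e a : R) :
  0 < a -> a <= 1 ->
  1 <= N -> 1 <= w -> w ^+ 2 <= N -> N `^ (2 * a) <= N * w ^+ 2 -> e ^+ 2 = 1 ->
  x = e * N + w * t -> y = e * N ^+ 3 + 3 * N ^+ 2 * (w * t) + N * w ^+ 2 * p ->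
  jbr ((y - x ^+ 3) ^+ 2 + (`|x| `^ (2 * a)) ^+ 2) <=
  8 * (N * w ^+ 2) * ((1 + p ^+ 2) * (1 + t ^+ 2) ^+ 2).
Proof.
move=> a0 a1 N1 w1 wN NaL e1 xE yE.
set L := N * w ^+ 2 in NaL yE *.
have N0 : 0 < N by lra.
have w0 : 0 < w by lra.
have wleN : w <= N by nra.
have L1 : 1 <= L by rewrite /L; nra.
apply: (le_trans (jbr_le _ _ (powR_ge0 _ _))).
have t0 := normr_ge0 t; have t2 : t ^+ 2 = `|t| ^+ 2 by rewrite real_normK ?num_real.
have p2 : p ^+ 2 = `|p| ^+ 2 by rewrite real_normK ?num_real.
have p0 := normr_ge0 p.
have e_norm : `|e| = 1 by rewrite -sqrtr_sqr e1 sqrtr1.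
have sig : y - x ^+ 3 = L * p - (3 * e * L * t ^+ 2 + w ^+ 3 * t ^+ 3).
  rewrite yE xE /L.
  have -> : (e * N + w * t) ^+ 3 = e ^+ 2 * e * N ^+ 3 + 3 * e ^+ 2 * N ^+ 2 * (w * t)
     + 3 * e * (N * w ^+ 2) * t ^+ 2 + w ^+ 3 * t ^+ 3 by ring.
  by rewrite e1; ring.
have w3 : w ^+ 3 <= L.
  by rewrite /L exprS ler_wpM2r// sqr_ge0.
have sigle : `|y - x ^+ 3| <= L * `|p| + (3 * L * `|t| ^+ 2 + L * `|t| ^+ 3).
  rewrite sig (le_trans (ler_normB _ _))// lerD//.
    by rewrite normrM (ger0_norm (_ : 0 <= L))//; lra.
  rewrite (le_trans (ler_normD _ _))// lerD//.
    by rewrite normrM normrX (normrM _ L) (normrM 3) e_norm mulr1 (ger0_norm (_ : 0 <= L)) ?(ger0_norm (_ : 0 <= 3))//; lra.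
  rewrite normrM !normrX (ger0_norm (ltW w0)) ler_wpM2r// exprn_ge0//.
have xle : `|x| <= N * (1 + `|t|).
  rewrite xE (le_trans (ler_normD _ _))// !normrM e_norm mul1r (ger0_norm (ltW N0)) (ger0_norm (ltW w0)).
  by rewrite mulrDr mulr1 lerD2l ler_wpM2r.
have rho : `|x| `^ (2 * a) <= L * (1 + `|t|) ^+ 2.
  have t1 : 0 <= 1 + `|t| by lra.
  apply: (@le_trans _ _ ((N * (1 + `|t|)) `^ (2 * a))).
    by apply: ge0_ler_powR; rewrite ?nnegrE ?mulr_ge0//; lra.
  rewrite powRM//; last lra.
  apply: ler_pM; rewrite ?powR_ge0//.
  rewrite -powR_mulrn// ler_powR//; lra.
apply: (@le_trans _ _ (1 + (L * `|p| + (3 * L * `|t| ^+ 2 + L * `|t| ^+ 3)) + L * (1 + `|t|) ^+ 2)).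
  by rewrite lerD// lerD.
rewrite p2 t2; move: (`|p|) (`|t|) p0 t0 => P T P0 T0.
set X := 1 + P ^+ 2; set K := 1 + T ^+ 2.
have X1 : 1 <= X by rewrite lerDl sqr_ge0.
have K1 : 1 <= K by rewrite lerDl sqr_ge0.
have pX : P <= X by rewrite /X; nra.
have tK : T <= K by rewrite /K; nra.
have t3 : T ^+ 3 <= K ^+ 2 by rewrite /K; nra.
have t22 : T ^+ 2 <= K by rewrite /K; lra.
have t4 : (1 + T) ^+ 2 <= 2 * K by rewrite /K; have := sqr_ge0 (1 - T); nra.
have K2 : K <= K ^+ 2 by nra.
have XK : K ^+ 2 <= X * K ^+ 2 by nra.
have XK2 : X <= X * K ^+ 2 by nra.
(* In units of $XK^2$ the five terms cost 1, 1, 3, 1 and 2, whence the constant 8. *)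
have S : 1 + P + 3 * T ^+ 2 + T ^+ 3 + (1 + T) ^+ 2 <= 8 * (X * K ^+ 2) by lra.
apply: (@le_trans _ _ (L * (1 + P + 3 * T ^+ 2 + T ^+ 3 + (1 + T) ^+ 2))).
  nra.
have -> : 8 * L * (X * K ^+ 2) = L * (8 * (X * K ^+ 2)) by ring.
by apply: ler_wpM2l => //; lra.
Qed.

End weight.

(** * Upper bound for the packet norms *)

Section upper.
Context {R : realType}.
Local Notation mR := (measurableTypeR R).
Local Notation mu := (@lebesgue_measure R).
Local Notation mu2 := (@leb2 R).

Lemma integrable_oneDsqrV : mu.-integrable setT (EFin \o (fun x : mR => (oneDsqr x)^-1)).
Proof.
have cV : continuous (fun x : R => (oneDsqr x)^-1) by exact: continuous_oneDsqrV.
apply/integrableP; split.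
  by apply/measurable_EFinP; apply: continuous_measurable_fun.
under eq_integral => x _.
  rewrite gee0_abs; last by rewrite lee_fin invr_ge0.
  over.
rewrite ge0_symfun_integralT//=.
- rewrite (_ : [set x : R | 0 <= x] = `[0, +oo[).
    by rewrite integral0y_oneDsqr -EFinM ltry.
  by apply/seteqP; split => x /=; rewrite in_itv /= andbT.
- by move=> x /=; rewrite /oneDsqr sqrrN.
Qed.

(** In the rescaled variables $p, t$ the weights grow polynomially. A bump of high enough order
    makes the transform decay faster, and the integrand is dominated by a multiple of
    $(1+p^2)^{-1}(1+t^2)^{-1}$. *)
Lemma weighted_integral_wave_le (alpha s : R) : 0 < alpha -> alpha <= 1 -> s <= 0 ->
  exists k : nat, exists2 C : R, 0 < C & forall N w e : R,
    1 <= N -> 1 <= w -> w ^+ 2 <= N -> N `^ (2 * alpha) <= N * w ^+ 2 -> e ^+ 2 = 1 ->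
  (\int[mu2]_(q in setT) ((Xweight alpha (1/2) s q) ^+ 2 *
    cabs2 (fourier (wave (e * N ^+ 3) (e * N)
       (packet k.+1 (N * w ^+ 2) w (3 * N ^+ 2)))) q)%:E <=
   (C * (N `^ (2 * s) / w))%:E)%E.
Proof.
move=> alpha0 alpha1 s0.
pose m := Num.bound (- s).
have sm : - s <= m%:R by rewrite ltW// archi_boundP// oppr_ge0.
(* With $K = 1 + t^2$, the two weights contribute $K^2$ and $K^{2m}$; the decay $K^{-(k+1)}$ cancels
   these and leaves exactly one factor $K^{-1}$. *)
pose k := (2 * m + 2)%N.
have [C C0 HC] := @cabs2_fourier_wave_le R k.
pose g (z : mR * mR) : R := (oneDsqr z.1)^-1 * (oneDsqr z.2)^-1.
have gi : mu2.-integrable setT (EFin \o g).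
  exact: (integrable_tensor _ _ integrable_oneDsqrV integrable_oneDsqrV).
have g0 z : 0 <= g z by rewrite mulr_ge0 ?invr_ge0.
pose J := fine (\int[mu2]_z (g z)%:E).
have JE : (\int[mu2]_z (g z)%:E = J%:E)%E.
  by rewrite fineK//; exact: integrable_fin_num.
have J0 : 0 <= J by rewrite fine_ge0//; apply: integral_ge0 => z _; rewrite lee_fin.
(* The summand 1 makes the constant strictly positive. *)
exists k, (8 * 4 ^+ m * C * J + 1).
  by rewrite ltr_pwDr// !mulr_ge0// exprn_ge0.
move=> N w e N1 w1 wN NaL e1.
set L := N * w ^+ 2 in NaL *.
have N0 : 0 < N by lra.
have w0 : 0 < w by lra.
have L0 : 0 < L by rewrite mulr_gt0// exprn_gt0.
pose Ns := N `^ (2 * s).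
have Ns0 : 0 <= Ns by exact: powR_ge0.
pose A := 8 * 4 ^+ m * C * L * Ns * (L * w) ^- 2.
have A0 : 0 <= A.
  apply: mulr_ge0; last by rewrite invr_ge0 sqr_ge0.
  apply: mulr_ge0 => //; apply: mulr_ge0; last exact: ltW.
  by apply: mulr_ge0 => //; apply: mulr_ge0 => //; rewrite exprn_ge0.
(* This map sends $(\tau,\xi)$ to the rescaled variables $(p,t)$ introduced below; integrating
   through it gains a factor $Lw$. *)
pose sh := shear2 (w^-1) (- (e * N) / w) (- (3 * N ^+ 2) / L) (L^-1)
   ((3 * N ^+ 2 * (e * N) - e * N ^+ 3) / L).
have wV0 : 0 < w^-1 by rewrite invr_gt0.
have LV0 : 0 < L^-1 by rewrite invr_gt0.
have [/measurable_EFinP mg _] := integrableP _ _ _ gi.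
apply: (@le_trans _ _ (\int[mu2]_z (A%:E * (EFin \o g) (sh z)))%E); last first.
  rewrite ge0_integralZl//; last first.
  - by move=> z _; rewrite lee_fin.
  - apply: (measurableT_comp (f := EFin \o g)); first exact/measurable_EFinP.
    exact: measurable_shear2.
  rewrite /sh (ge0_integral_shear2 _ _ _ _ _ wV0 LV0 (EFin \o g))//; last first.
  - exact/measurable_EFinP.
  rewrite JE -!EFinM lee_fin.
  have -> : A * ((w^-1 * L^-1)^-1 * J) = (8 * 4 ^+ m * C * J) * (Ns / w).
    by rewrite /A; field; rewrite !gt_eqF.
  by rewrite ler_wpM2r ?divr_ge0 ?(ltW w0)// lerDl.
apply: le_integral_nonneg => q.
  by rewrite lee_fin mulr_ge0 ?sqr_ge0// addr_ge0 ?sqr_ge0.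
rewrite -EFinM lee_fin.
set p := (q.1 - e * N ^+ 3 - 3 * N ^+ 2 * (q.2 - e * N)) / L.
set t := (q.2 - e * N) / w.
have -> : g (sh q) = (1 + p ^+ 2)^-1 * (1 + t ^+ 2)^-1.
  rewrite /g /sh /shear2 /oneDsqr /=; congr ((1 + _ ^+ 2)^-1 * (1 + _ ^+ 2)^-1).
    by rewrite /p; field; rewrite gt_eqF.
  by rewrite /t; field; rewrite gt_eqF.
have xE : q.2 = e * N + w * t by rewrite /t; field; rewrite gt_eqF.
have yE : q.1 = e * N ^+ 3 + 3 * N ^+ 2 * (w * t) + L * p.
  by rewrite /p /t; field; rewrite !gt_eqF.
have W1 := dispersive_weight _ _ _ _ _ _ _ _ alpha0 alpha1 N1 w1 wN NaL e1 xE yE.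
have W2 := low_frequency_weight _ _ _ _ _ _ _ N1 w1 wN e1 xE s0 sm.
have F := HC L w (3 * N ^+ 2) (e * N ^+ 3) (e * N) q L0 w0.
rewrite -/p -/t in F.
rewrite Xweight_half_sqr.
set X := 1 + p ^+ 2 in W1 F *; set K := 1 + t ^+ 2 in W1 W2 F *.
have X0 : 0 < X by rewrite ltr_pwDl// sqr_ge0.
have K0 : 0 < K by rewrite ltr_pwDl// sqr_ge0.
have X1 : 1 <= X by rewrite lerDl sqr_ge0.
set F' := cabs2 _ _ in F *.
have F0 : 0 <= F' by rewrite addr_ge0 ?sqr_ge0.
have Fle : F' <= C * (L * w) ^- 2 / (X ^+ k.+1 * K ^+ k.+1).
  have D0 : 0 < X ^+ k.+1 * K ^+ k.+1 by apply: mulr_gt0; exact: exprn_gt0.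
  by rewrite ler_pdivlMr// [leLHS]mulrC.
apply: (@le_trans _ _ ((8 * L * (X * K ^+ 2)) * (Ns * (4 * K ^+ 2) ^+ m) *
    (C * (L * w) ^- 2 / (X ^+ k.+1 * K ^+ k.+1)))).
  apply: ler_pM => //; first by apply: mulr_ge0; [exact: sqrtr_ge0|exact: powR_ge0].
  by apply: ler_pM => //; [exact: sqrtr_ge0|exact: powR_ge0].
have -> : (8 * L * (X * K ^+ 2)) * (Ns * (4 * K ^+ 2) ^+ m) *
    (C * (L * w) ^- 2 / (X ^+ k.+1 * K ^+ k.+1)) = A * (X ^- k * K^-1).
  have -> : K ^+ k.+1 = (K ^+ 2) ^+ m * K ^+ 2 * K.
    by rewrite -exprM -exprD /k -exprSr.
  rewrite [(4 * _) ^+ m]exprMn [X ^+ k.+1]exprSr /A.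
  move: (K ^+ 2 ^+ m) (X ^+ k) (exprn_gt0 m (exprn_gt0 2 K0)) (exprn_gt0 k X0).
  by move=> Km Xk Km0 Xk0; field; rewrite !gt_eqF.
(* In $X = 1 + p^2$ the surplus decay $X^{-k}$ is weakened to $X^{-1}$, as $X \ge 1$ and $k \ge
   1$. *)
rewrite ler_wpM2l// ler_wpM2r ?invr_ge0 ?(ltW K0)//.
rewrite lef_pV2 ?posrE ?exprn_gt0//.
by rewrite -[leLHS]expr1 ler_weXn2l// /k addnS.
Qed.
End upper.

(** * Lower bound for the product *)

Section lower.
Context {R : realType}.
Local Notation mR := (measurableTypeR R).
Local Notation mu := (@lebesgue_measure R).
Local Notation mu2 := (@leb2 R).

Lemma cos_ge_cos1 (x : R) : `|x| <= 1 -> cos 1 <= cos x.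
Proof.
move=> x1; rewrite -(cos_norm x).
have pi1 : 1 <= pi :> R by have := @pihalf_ge1 R; lra.
by rewrite leNgt ltr_cos ?in_itv/= ?normr_ge0 ?ler01 ?(le_trans x1 pi1)// -leNgt.
Qed.

Lemma lebesgue_measure_segment (a b : R) : a < b -> mu `[a, b] = (b - a)%:E.
Proof. by move=> ab; rewrite lebesgue_measure_itv /= lte_fin ab -EFinD. Qed.

(** On $[-1/2,1/2]$, an interval of length 1, the bump is at least $(3/4)^{k+1}$. *)
Lemma Rintegral_bump_gt0 k : 0 < \int[mu]_x (bump k.+1 x) :> R.
Proof.
have bi := integrable_bump_self k.
pose I : set R := `[- (1 / 2), 1 / 2]%classic.
have mI : measurable (I : set mR) by exact: measurable_itv.
apply: (@lt_le_trans _ _ ((3 / 4) ^+ k.+1)); first by rewrite exprn_gt0//; lra.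
rewrite -lee_fin /Rintegral fineK; last exact: integrable_fin_num.
apply: (@le_trans _ _ (\int[mu]_x (((3 / 4) ^+ k.+1)%:E * (\1_I x)%:E))%E).
  have mI1 : measurable_fun [set: mR] (fun x => (\1_I x : R)%:E).
    by apply/measurable_EFinP; exact: measurable_indic.
  rewrite (ge0_integralZl mu measurableT mI1)//.
  rewrite integral_indic// setIT.
  have muI : mu I = 1%:E.
    by rewrite lebesgue_measure_segment; [congr _%:E; lra|lra].
  by rewrite [X in (_ <= _ * X)%E]muI mule1.
apply: le_integral_nonneg => x.
  by rewrite -EFinM lee_fin mulr_ge0// exprn_ge0//; lra.
rewrite -EFinM lee_fin indicE; have [|] := boolP (x \in I); last by rewrite mulr0 bump_ge0.
rewrite inE /I /= in_itv /= mulr1 => /andP[x1 x2].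
have h : 3 / 4 <= Num.max 0 (1 - x ^+ 2) by rewrite le_max; apply/orP; right; nra.
by rewrite /bump lerXn2r ?nnegrE//; lra.
Qed.

(** On the support $[-1,1]^2$ the phase is at most 1 in absolute value, so the cosine stays above
    $\cos 1 > 0$ and nothing cancels. *)
Lemma bump2_fourier_ge k : exists2 c : R, 0 < c & forall p q : R,
  `|p| <= 1 / 2 -> `|q| <= 1 / 2 ->
  c <= Rintegral mu2 setT (fun z => cos (z.1 * p + z.2 * q) * bump2 k.+1 z).
Proof.
have bi := @integrable_bump_self R k.
exists (cos 1 * (\int[mu]_x (bump k.+1 x) * \int[mu]_x (bump k.+1 x))).
  by rewrite !mulr_gt0 ?Rintegral_bump_gt0// cos1_gt0.
move=> p q p1 q1.
rewrite -Rintegral_tensor// -RintegralZl//; last exact: integrable_bump2.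
apply: le_Rintegral => //.
- exact: (integrable_phase_bump2 k (cst (cos 1)) 0 0 (fun x => cvg_cst _) (fun x => cos_norm_le1 1)).
- by apply: integrable_phase_bump2; [exact: continuous_cos|exact: cos_norm_le1].
move=> z _; rewrite -/(bump2 k.+1 z).
have [z1|z1] := leP `|z.1| 1; last by rewrite /bump2 bump_eq0// mul0r !mulr0.
have [z2|z2] := leP `|z.2| 1; last by rewrite /bump2 (bump_eq0 _ z.2)// !mulr0.
rewrite ler_wpM2r ?bump2_ge0// cos_ge_cos1//.
rewrite (le_trans (ler_normD _ _))// !normrM.
have := normr_ge0 z.1; have := normr_ge0 z.2; have := normr_ge0 p; have := normr_ge0 q.
nra.
Qed.

(** The two factors are complex conjugates, so the carrier disappears. Writing the product as a wave
    of frequency zero lets the Fourier formulas for waves apply to it. *)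
Lemma cmul_conj_wave (a b : R) (P : R * R -> R) :
  cmul (wave a b P) (wave (- a) (- b) P) = wave 0 0 (fun z => P z ^+ 2).
Proof.
rewrite /cmul /wave /=; congr pair; apply/funext => z;
  rewrite !mulrN -opprD sinN cosN !mulr0 addr0.
  rewrite cos0 mul1r; have := cos2Dsin2 (z.1 * a + z.2 * b).
  move: (cos _) (sin _) => c d cd; rewrite -[RHS]mul1r -cd; ring.
by rewrite sin0; ring.
Qed.

End lower.

Section lower_norm.
Context {R : realType}.
Local Notation mR := (measurableTypeR R).
Local Notation mu := (@lebesgue_measure R).
Local Notation mu2 := (@leb2 R).

(** Near the line $y = 3N^2x$ with $x \sim w$ the modulation is of order $N^2w$, which dominates
    every other term of the bracket. As $d$ and $s$ are nonpositive, upper bounds on the brackets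
    give lower bounds on the weight. *)
Lemma Xweight_sqr_ge (alpha s b d N w x y : R) :
  0 < alpha -> alpha <= 1 -> s <= 0 -> d <= b -> d <= 0 ->
  1 <= N -> 1 <= w -> w ^+ 2 <= N ->
  w / 4 <= x -> x <= w / 2 -> `|y - 3 * N ^+ 2 * x| <= N * w ^+ 2 / 2 ->
  (8 * (N ^+ 2 * w)) `^ (2 * d) * (2 * w ^+ 2) `^ s <= (Xweight alpha b s (y, x)) ^+ 2.
Proof.
move=> a0 a1 s0 db d0 N1 w1 wN x1 x2 yx.
have wleN : w <= N by nra.
rewrite /Xweight /= exprMn.
apply: ler_pM; rewrite ?powR_ge0//; last first.
  rewrite powR_sqr jbr_powR ?sqr_ge0// mulfK ?pnatr_eq0//.
  by apply: ler_npowR => //; nra.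
set z := (y - x ^+ 3) ^+ 2 + _.
have z0 : 0 <= z by rewrite addr_ge0 ?sqr_ge0.
have j1 : 1 <= jbr z by exact: jbr_ge1.
rewrite powR_sqr.
(* The bracket is at least 1, so lowering the exponent from $b$, which may be positive, to $d$ only
   decreases the weight. *)
apply: (@le_trans _ _ (jbr z `^ (2 * d))); last by rewrite ler_powR//; lra.
apply: ler_npowR; [lra| |lra].
rewrite /z; apply: (le_trans (jbr_le _ _ (powR_ge0 _ _))).
have x0 : 0 < x by lra.
have rho : `|x| `^ (2 * alpha) <= w ^+ 2.
  apply: (@le_trans _ _ (w `^ (2 * alpha))).
    by apply: ge0_ler_powR; rewrite ?nnegrE ?gtr0_norm//; lra.
  by rewrite -powR_mulrn; [rewrite ler_powR//; lra|lra].
have sig : `|y - x ^+ 3| <= N * w ^+ 2 / 2 + 3 * N ^+ 2 * x + x ^+ 3.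
  rewrite (_ : y - x ^+ 3 = (y - 3 * N ^+ 2 * x) + (3 * N ^+ 2 * x - x ^+ 3)); last by ring.
  apply: (le_trans (ler_normD _ _)); rewrite -addrA; apply: lerD => //.
  apply: (le_trans (ler_normB _ _)).
  have h1 : 0 <= 3 * N ^+ 2 * x by apply: mulr_ge0; [apply: mulr_ge0; rewrite ?sqr_ge0|exact: ltW].
  have h2 : 0 <= x ^+ 3 by apply: exprn_ge0; exact: ltW.
  by rewrite !ger0_norm.
have x3 : x ^+ 3 <= w ^+ 3 by rewrite lerXn2r ?nnegrE; lra.
have Nw : N * w ^+ 2 <= N ^+ 2 * w by nra.
have w3 : w ^+ 3 <= N ^+ 2 * w by rewrite exprSr ler_wpM2r; nra.
have w2 : w ^+ 2 <= N ^+ 2 * w by nra.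
have one : 1 <= N ^+ 2 * w by nra.
have Nx : N ^+ 2 * x <= N ^+ 2 * w / 2 by rewrite -mulrA ler_wpM2l ?sqr_ge0.
rewrite -(mulrA 3) in sig; lra.
Qed.

(** The integral is restricted to a parallelogram of area $Lw/4$ on which $\xi \ge w/4$ and the
    transform of the product is at least $c/(Lw)$. *)
Lemma weighted_integral_dx_prod_ge (alpha s b d : R) (k : nat) :
  0 < alpha -> alpha <= 1 -> s <= 0 -> d <= b -> d <= 0 ->
  exists2 c : R, 0 < c & forall N w : R,
    1 <= N -> 1 <= w -> w ^+ 2 <= N ->
  let P := packet k.+1 (N * w ^+ 2) w (3 * N ^+ 2) in
  ((c * ((N ^+ 2 * w) `^ (2 * d) * (w ^+ 2) `^ s / (N * w)))%:E <=
   \int[mu2]_(q in setT) ((Xweight alpha b s q) ^+ 2 *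
     cabs2 (mul_ixi (fourier (cmul (wave (N ^+ 3) N P) (wave (- N ^+ 3) (- N) P)))) q)%:E)%E.
Proof.
move=> a0 a1 s0 db d0.
(* Squaring the envelope doubles its order: [k.+1 * 2] is [(k * 2).+2]. *)
have [c c0 Hc] := @bump2_fourier_ge R (k * 2).+1.
(* The 64 is $4^2$ from $\xi^2 \ge (w/4)^2$ times 4 from the area; the powers of 8 and 2 come from
   [Xweight_sqr_ge]. *)
exists (8 `^ (2 * d) * 2 `^ s * (c ^+ 2 / 64)).
  by rewrite !mulr_gt0 ?powR_gt0 ?exprn_gt0 ?invr_gt0.
move=> N w N1 w1 wN /=.
set L := N * w ^+ 2.
have N0 : 0 < N by lra.
have w0 : 0 < w by lra.
have L0 : 0 < L by rewrite mulr_gt0// exprn_gt0.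
have wV0 : 0 < w^-1 by rewrite invr_gt0.
have LV0 : 0 < L^-1 by rewrite invr_gt0.
rewrite cmul_conj_wave.
have -> : (fun z => packet k.+1 L w (3 * N ^+ 2) z ^+ 2) = packet (k * 2).+2 L w (3 * N ^+ 2).
  by apply/funext => z; rewrite packetM mulSn.
pose I1 : set mR := `[- (1 / 2), 1 / 2]%classic.
(* The range of $\xi/w$ stays away from 0, where the derivative factor vanishes. *)
pose I2 : set mR := `[1 / 4, 1 / 2]%classic.
have mI1 : measurable I1 by exact: measurable_itv.
have mI2 : measurable I2 by exact: measurable_itv.
have mI : measurable (I1 `*` I2) by exact: measurableX.
pose f (z : mR * mR) : \bar R := (\1_(I1 `*` I2) z)%:E.
have mf : measurable_fun setT f by apply/measurable_EFinP; exact: measurable_indic.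
have f0 z : (0 <= f z)%E by rewrite lee_fin.
pose K0 := (8 * (N ^+ 2 * w)) `^ (2 * d) * (2 * w ^+ 2) `^ s * ((w / 4) ^+ 2 * (c / (L * w)) ^+ 2).
have K00 : 0 <= K0.
  by apply: mulr_ge0; apply: mulr_ge0; rewrite ?powR_ge0 ?sqr_ge0.
pose sh := shear2 (w^-1) 0 (- (3 * N ^+ 2) / L) (L^-1) 0.
apply: (@le_trans _ _ (\int[mu2]_z (K0%:E * f (sh z)))%E).
  have mfs : measurable_fun setT (f \o sh).
    by apply: (measurableT_comp mf); exact: measurable_shear2.
  rewrite (ge0_integralZl mu2 measurableT mfs)//; last by move=> z _; exact: f0.
  rewrite /sh (ge0_integral_shear2 _ _ _ _ _ wV0 LV0 f)//.
  have -> : (\int[mu2]_z f z = (1 / 4)%:E)%E.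
    rewrite /f integral_indic// setIT.
    rewrite [LHS](product_measure1E mu mu mI1 mI2).
    rewrite -[RHS]mul1e; congr (_ * _)%E.
      by rewrite [LHS]lebesgue_measure_segment; [congr _%:E; lra|lra].
    by rewrite [LHS]lebesgue_measure_segment; [congr _%:E; lra|lra].
  rewrite -!EFinM lee_fin le_eqVlt; apply/orP; left; apply/eqP.
  have Nw0 : 0 <= N ^+ 2 * w by apply: mulr_ge0; [exact: sqr_ge0|exact: ltW].
  rewrite /K0 (@powRM _ 8 (N ^+ 2 * w))// (@powRM _ 2 (w ^+ 2)) ?sqr_ge0//.
  move: (8 `^ _) ((N ^+ 2 * w) `^ _) (2 `^ s) ((w ^+ 2) `^ s) => A1 A2 A4 A5.
  by rewrite /L; field; rewrite !gt_eqF.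
apply: le_integral_nonneg => q; first by rewrite mule_ge0// lee_fin.
rewrite /f -EFinM lee_fin indicE.
have [|_] := boolP (sh q \in I1 `*` I2); last first.
  by rewrite mulr0 mulr_ge0 ?sqr_ge0// addr_ge0 ?sqr_ge0.
rewrite inE mulr1 /I1 /I2 /sh /shear2 => -[/=]; rewrite !in_itv /= => /andP[h1 h2] /andP[h3 h4].
have E1 : L^-1 * q.1 + (- (3 * N ^+ 2) / L * q.2 + 0) = (q.1 - 3 * N ^+ 2 * q.2) / L.
  by field; rewrite gt_eqF.
have E2 : w^-1 * q.2 + 0 = q.2 / w by rewrite addr0 mulrC.
rewrite E1 in h1 h2; rewrite E2 in h3 h4.
have yx : `|q.1 - 3 * N ^+ 2 * q.2| <= L / 2.
  rewrite ler_norml; move: h1 h2; rewrite ler_pdivlMr// ler_pdivrMr//.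
  by move=> *; apply/andP; split; lra.
have x1 : w / 4 <= q.2 by move: h3; rewrite ler_pdivlMr//; lra.
have x2 : q.2 <= w / 2 by move: h4; rewrite ler_pdivrMr//; lra.
apply: ler_pM.
- by rewrite mulr_ge0 ?powR_ge0.
- by rewrite mulr_ge0 ?sqr_ge0.
- by rewrite [q in Xweight _ _ _ q]surjective_pairing; apply: (Xweight_sqr_ge _ _ _ _ N).
rewrite /cabs2 /mul_ixi /=.
(* Only the real part of the transform, the cosine integral bounded below by [bump2_fourier_ge], is
   kept. *)
apply: (@le_trans _ _ ((q.2 * (fourier (wave 0 0 (packet (k * 2).+2 L w (3 * N ^+ 2)))).1 q) ^+ 2)); last first.
  by rewrite lerDr sqr_ge0.
have F1 : c / (L * w) <= (fourier (wave 0 0 (packet (k * 2).+2 L w (3 * N ^+ 2)))).1 q.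
  rewrite fourier_wave1 !sub0r.
  rewrite (Rintegral_phase_packet _ _ _ _ _ _ _ L0 w0 (@continuous_cos R) cos_norm_le1).
  rewrite [leLHS]mulrC; apply: ler_wpM2l; first by rewrite invr_ge0 mulr_ge0 ?(ltW L0) ?(ltW w0).
  apply: Hc.
    rewrite mulrN -opprD mulNr normrN normrM (gtr0_norm LV0) ler_pdivrMr//.
    by apply: (le_trans yx); lra.
  rewrite mulNr normrN ger0_norm; first exact: h4.
  by rewrite divr_ge0// ltW//; lra.
have c1 : 0 <= c / (L * w) by rewrite divr_ge0 ?mulr_ge0// ltW.
rewrite -exprMn lerXn2r ?nnegrE//.
- by rewrite mulr_ge0// ltW// divr_gt0.
- by rewrite mulr_ge0// ?(le_trans _ F1)// ltW//; lra.
by rewrite ler_pM// ltW// divr_gt0.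
Qed.
End lower_norm.

(** * Choice of exponents and comparison of the two sides *)

Section assembly.
Context {R : realType}.
Local Notation mR := (measurableTypeR R).
Local Notation mu2 := (@leb2 R).

Lemma lee_pmul2 (k x y X Y : \bar R) : (0 <= k)%E -> (0 <= x)%E -> (0 <= y)%E ->
  (x <= X)%E -> (y <= Y)%E -> (k * x * y <= k * X * Y)%E.
Proof.
move=> k0 x0 y0 xX yY; apply: lee_pmul => //; first exact: mule_ge0.
exact: lee_wpmul2l.
Qed.

Lemma poweR_half_le (x : \bar R) (A : R) : (0 <= x)%E -> (x <= A%:E)%E ->
  (x `^ (1 / 2) <= (Num.sqrt A)%:E)%E.
Proof.
move=> x0 xA; have A0 : 0 <= A by rewrite -lee_fin (le_trans x0).
rewrite -powR12_sqrt// -poweR_EFin div1r.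
by apply: gt0_ler_poweR; rewrite ?in_itv/= ?leey ?andbT//; lra.
Qed.

Lemma poweR_half_ge (x : \bar R) (B : R) : 0 <= B -> (B%:E <= x)%E ->
  ((Num.sqrt B)%:E <= x `^ (1 / 2))%E.
Proof.
move=> B0 Bx; have x0 : (0 <= x)%E by apply: le_trans Bx; rewrite lee_fin.
rewrite -powR12_sqrt// -poweR_EFin div1r.
by apply: gt0_ler_poweR; rewrite ?in_itv/= ?leey ?andbT// ?lee_fin//; lra.
Qed.

Lemma cintegrable_wave (a b L w c : R) (k : nat) : 0 < L -> 0 < w ->
  cintegrable (wave a b (packet k.+1 L w c)).
Proof.
move=> L0 w0; split.
  exact: (integrable_phase_packet _ _ _ _ _ _ _ L0 w0 (@continuous_cos R) cos_norm_le1).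
exact: (integrable_phase_packet _ _ _ _ _ _ _ L0 w0 (@continuous_sin R) sin_norm_le1).
Qed.

Lemma time_supp_wave (T a b L w c : R) (k : nat) : 0 < T -> 1 <= L * T ->
  time_supp_in T (wave a b (packet k.+1 L w c)).
Proof.
move=> T0 LT [t x] /= tT.
have L0 : 0 < L by rewrite -(pmulr_lgt0 _ T0) (lt_le_trans ltr01).
have P0 : packet k.+1 L w c (t, x) = 0.
  rewrite /packet bump_eq0 ?mul0r//= normrM (gtr0_norm L0).
  by rewrite (le_lt_trans LT)// ltr_pM2l.
by rewrite P0 !mulr0.
Qed.

(** With $w = N^\beta$ the third and fourth bounds say $w^2 \le N$ and $N^{2\alpha} \le Nw^2$. For
    $\alpha > 1/2$ one has $2\beta s - 4s = -(5-2\alpha)s$, which is at least 3 exactly when $s \le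
    s_\alpha$; for $\beta = 0$ the condition is $s \le -3/4$. *)
Lemma s_alpha_exponent (alpha s : R) : 0 < alpha -> alpha <= 1 -> s <= s_alpha alpha ->
  let beta := Num.max 0 (alpha - 1 / 2) in
  [/\ s <= 0, 0 <= beta, 2 * beta <= 1, 2 * alpha <= 1 + 2 * beta & 0 <= - 3 + 2 * beta * s - 4 * s].
Proof.
move=> a0 a1; rewrite /s_alpha.
case: ifPn => [a2 sa /=|]; first by rewrite max_l; [split; lra|lra].
rewrite -ltNge => a2 sa /=; rewrite max_r; last lra.
have D0 : 0 < 5 - 2 * alpha by lra.
have sD : s * (5 - 2 * alpha) <= - 3 by rewrite -ler_pdivlMr// mulNr.
split; nra.
Qed.

(** Both sides are constants times powers of $N$. The exponent on the right exceeds the one on the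
    left by $4(d+1/2) + (-3+2\beta s-4s) + \beta(2d+1)$, whose last two terms are nonnegative. *)
Lemma ratio_growth (s beta d c C1 Ct N : R) : 0 < N -> 1 <= N -> 0 < c -> 0 <= Ct -> 0 <= C1 ->
  0 <= beta -> - (1 / 2) < d ->
  0 <= - 3 + 2 * beta * s - 4 * s ->
  (Ct * C1) ^+ 2 / c < N `^ (4 * (d + 1 / 2)) ->
  (Ct * (C1 * (N `^ (2 * s) / N `^ beta))) ^+ 2 <
  c * ((N ^+ 2 * N `^ beta) `^ (2 * d) * ((N `^ beta) ^+ 2) `^ s / (N * N `^ beta)).
Proof.
move=> N0 N1 c0 Ct0 C10 b0 d0 crit big.
have D (x y : R) : N `^ x * N `^ y = N `^ (x + y) by rewrite powRD// (gt_eqF N0) implybT.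
have Q (x y : R) : N `^ x / N `^ y = N `^ (x - y) by rewrite -powRN D.
have N2 : N ^+ 2 = N `^ 2 by rewrite powR_mulrn// ltW.
have -> : (N ^+ 2 * N `^ beta) `^ (2 * d) = N `^ ((2 + beta) * (2 * d)).
  by rewrite N2 D -powRrM.
have -> : ((N `^ beta) ^+ 2) `^ s = N `^ (beta * 2 * s) by rewrite powR_sqr -powRrM.
have -> : N * N `^ beta = N `^ (1 + beta) by rewrite -D powRr1// ltW.
rewrite D !Q mulrA exprMn powR_sqr.
set x := (_ - beta) * 2; set y := (_ - (1 + beta)).
have h : 4 * (d + 1 / 2) + x <= y by rewrite /x /y; nra.
have px : 0 < N `^ x by rewrite powR_gt0.
apply: (@lt_le_trans _ _ (c * (N `^ (4 * (d + 1 / 2)) * N `^ x))); last first.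
  by rewrite D ler_pM2l// ler_powR.
by rewrite [ltRHS]mulrA ltr_pM2r// [ltRHS]mulrC -ltr_pdivrMr.
Qed.

End assembly.

Theorem theorem1p2 (R : realType) (alpha s nu delta T : R) :
  0 < alpha -> alpha <= 1 -> s <= s_alpha alpha ->
  0 < nu -> 0 < delta -> 0 < T ->
  forall C : R, 0 < C ->
  exists u v : cfun R,
    [/\ cintegrable u /\ cintegrable v /\ cintegrable (cmul u v),
        time_supp_in T u /\ time_supp_in T v,
        (Xnorm alpha (1/2) s u < +oo)%E /\ (Xnorm alpha (1/2) s v < +oo)%E &
        (((C * T `^ nu)%:E * Xnorm alpha (1/2) s u * Xnorm alpha (1/2) s v)
           < Xnorm_dx_prod alpha (-(1/2) + delta) s u v)%E].
Proof.
move=> a0 a1 sa nu0 delta0 T0 C C0.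
have [s0 b0 b1 ab crit] := s_alpha_exponent alpha s a0 a1 sa.
set beta := Num.max 0 (alpha - 1 / 2) in b0 b1 ab crit.
have [k [C1 C10 upper]] := weighted_integral_wave_le alpha s a0 a1 s0.
(* Capping $\delta$ at $1/2$ gives an exponent in $(-1/2, 0]$ not above $-1/2+\delta$, as the lower
   bound demands. *)
pose d := Num.min delta (1 / 2) - 1 / 2.
have d1 : d <= - (1 / 2) + delta by rewrite /d addrC lerD2l ge_min lexx.
have d2 : d <= 0 by rewrite /d subr_le0 ge_min lexx orbT.
have d3 : - (1 / 2) < d by rewrite /d ltrBrDr addNr lt_min delta0; lra.
have [c c0 lower] := weighted_integral_dx_prod_ge alpha s (- (1 / 2) + delta) d k a0 a1 s0 d1 d2.
pose Ct := C * T `^ nu.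
have Ct0 : 0 < Ct by rewrite mulr_gt0// powR_gt0.
pose M := (Ct * C1) ^+ 2 / c.
have M0 : 0 <= M by rewrite divr_ge0 ?sqr_ge0// ltW.
pose r := 4 * (d + 1 / 2).
have r0 : 0 < r by rewrite /r; lra.
(* The three summands ensure $N^r > M$, $NT \ge 1$ for the time support, and $N \ge 1$. *)
pose N := (1 + M) `^ r^-1 + T^-1 + 1.
have TV0 : 0 < T^-1 by rewrite invr_gt0.
have pM := powR_ge0 (1 + M) r^-1.
have N1 : 1 <= N by rewrite /N; lra.
have N0 : 0 < N by lra.
have NT : 1 <= N * T by rewrite -ler_pdivrMr// div1r /N; lra.
have big : M < N `^ r.
  apply: (@lt_le_trans _ _ (1 + M)); first by lra.
  have -> : 1 + M = ((1 + M) `^ r^-1) `^ r.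
    by rewrite -powRrM mulVf ?gt_eqF// powRr1//; lra.
  by apply: ge0_ler_powR; rewrite ?nnegrE ?(ltW r0) ?(ltW N0)// /N; lra.
pose w := N `^ beta.
have w1 : 1 <= w by rewrite /w -[leLHS](powRr0 N) ler_powR.
have w0 : 0 < w by lra.
have w2 : w ^+ 2 = N `^ (2 * beta) by rewrite powR_sqr mulrC.
have wN : w ^+ 2 <= N by rewrite w2 -[leRHS]powRr1 ?(ltW N0)// ler_powR.
have NaL : N `^ (2 * alpha) <= N * w ^+ 2.
  have -> : N * w ^+ 2 = N `^ (1 + 2 * beta).
    by rewrite w2 powRD ?(gt_eqF N0) ?implybT// powRr1// ltW.
  by rewrite ler_powR.
have L0 : 0 < N * w ^+ 2 by rewrite mulr_gt0// exprn_gt0.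
have LT : 1 <= N * w ^+ 2 * T.
  by rewrite mulrAC (le_trans NT)// ler_peMr ?exprn_ege1//; lra.
pose P := packet k.+1 (N * w ^+ 2) w (3 * N ^+ 2).
pose u := wave (N ^+ 3) N P.
pose v := wave (- N ^+ 3) (- N) P.
pose A := C1 * (N `^ (2 * s) / w).
have e1 : 1 ^+ 2 = 1 :> R by rewrite expr1n.
have e2 : (- 1) ^+ 2 = 1 :> R by rewrite sqrrN expr1n.
have hu : (Xnorm alpha (1/2) s u <= (Num.sqrt A)%:E)%E.
  apply: poweR_half_le; last first.
    by have := upper N w 1 N1 w1 wN NaL e1; rewrite !mul1r.
  by apply: integral_ge0 => q _; rewrite lee_fin mulr_ge0 ?sqr_ge0// addr_ge0 ?sqr_ge0.
have hv : (Xnorm alpha (1/2) s v <= (Num.sqrt A)%:E)%E.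
  apply: poweR_half_le; last first.
    by have := upper N w (- 1) N1 w1 wN NaL e2; rewrite !mulN1r.
  by apply: integral_ge0 => q _; rewrite lee_fin mulr_ge0 ?sqr_ge0// addr_ge0 ?sqr_ge0.
exists u, v; split.
- split; first exact: cintegrable_wave.
  split; first exact: cintegrable_wave.
  rewrite cmul_conj_wave (_ : (fun z => P z ^+ 2) = packet (k * 2).+2 (N * w ^+ 2) w (3 * N ^+ 2)).
    exact: cintegrable_wave.
  by apply/funext => z; rewrite packetM mulSn.
- by split; exact: time_supp_wave.
- by split; [apply: (le_lt_trans hu)|apply: (le_lt_trans hv)]; exact: ltry.
have A0 : 0 <= A by rewrite mulr_ge0 ?divr_ge0 ?powR_ge0// ltW.
(* Each factor norm is at most $\sqrt{A}$, so the left side is at most $C T^\nu A$; it is compared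
   with $\sqrt{B}$ by squaring. *)
apply: (@le_lt_trans _ _ (Ct * A)%:E).
  apply: (@le_trans _ _ (Ct%:E * (Num.sqrt A)%:E * (Num.sqrt A)%:E)%E).
    by apply: (lee_pmul2 _ _ _ _ _ _ _ _ hu hv); rewrite ?poweR_ge0// lee_fin ltW.
  by rewrite -!EFinM lee_fin -mulrA -expr2 sqr_sqrtr.
pose B := c * ((N ^+ 2 * w) `^ (2 * d) * (w ^+ 2) `^ s / (N * w)).
have AB : (Ct * A) ^+ 2 < B.
  by apply: ratio_growth => //; exact: ltW.
have B0 : 0 <= B by rewrite (le_trans _ (ltW AB))// sqr_ge0.
apply: (@lt_le_trans _ _ (Num.sqrt B)%:E).
  rewrite lte_fin -[ltLHS]ger0_norm; last by rewrite mulr_ge0// ltW.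
  by rewrite -sqrtr_sqr ltr_sqrt// (le_lt_trans _ AB)// sqr_ge0.
apply: poweR_half_ge => //.
exact: lower N w N1 w1 wN.
Qed.
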